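(* Let $\zeta=p/q$ with integers $p>q\geq 2$ and $\gcd(p,q)=1$. Then \[\tau(p/q)\leq \tilde{\epsilon}_1(p/q)\leq \min\left\{\frac12,\frac{q}{2(p-q)}\right\},\qquad \max\left\{\tau(p/q),\frac{q}{2(p+q)}\right\}\leq \tilde{\epsilon}_2(p/q)\leq \min\left\{\frac12,\frac{q-1}{p-q}\right\}.\] If $q$ is odd, then moreover \[\tilde{\epsilon}_1(p/q)\leq \min\left\{\frac12,\frac{q-1}{2(p-q)}\right\},\qquad \max\left\{\tau(p/q),\frac{q+1}{2(p+q)}\right\}\leq \tilde{\epsilon}_2(p/q).\] If $q=2$, then moreover $\tilde{\epsilon}_1(p/q)\leq 1/p$.
   Context: For real $x$, $\Vert x\Vert$ denotes the distance from $x$ to the nearest integer. For real $\zeta>1$ and $\epsilon>0$, let $\varpi_{\epsilon,\zeta}$ be the set of all real $\alpha\neq 0$ such that $\Vert\alpha\zeta^n\Vert\leq\epsilon$ for all integers $n\geq n_0$, for some integer $n_0=n_0(\alpha,\zeta,\epsilon)$. Define $\tilde{\epsilon}_1(\zeta):=\sup\{\epsilon>0:\varpi_{\epsilon,\zeta}=\emptyset\}$ and $\tilde{\epsilon}_2(\zeta):=\sup\{\epsilon>0: \varpi_{\epsilon,\zeta}\text{ is at most countable}\}$, with $\sup\emptyset=0$. For real $z$ let $E(z):=\frac{1-(1-z)\prod_{m\geq 0}(1-z^{2^m})}{2z}$, and for a rational $p/q$ in lowest terms let $\tau(p/q):=E(q/p)/p$. *)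

(* Defs.v *)
From mathcomp Require Import all_boot all_order all_algebra.
From mathcomp Require Import all_classical all_reals all_analysis.
Set Implicit Arguments.
Unset Strict Implicit.
Unset Printing Implicit Defensive.
Import Order.TTheory GRing.Theory Num.Theory.
Import numFieldNormedType.Exports.
Local Open Scope classical_set_scope.
Local Open Scope ring_scope.

Definition dist_int (R : realType) (x : R) : R :=
  inf [set `|x - k%:~R| | k in [set: int]].

Definition varpi (R : realType) (eps zeta : R) : set R :=
  [set alpha | alpha != 0 /\
    exists n0 : int, forall n : int, n0 <= n ->
      dist_int (alpha * zeta ^ n) <= eps].

(* [sup] is the real supremum with [sup set0 = 0]; both sets below are bounded
   above by 1/2, since [varpi eps zeta] is all of [R \ {0}] for eps >= 1/2. *)
Definition eps1 (R : realType) (zeta : R) : R :=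
  sup [set eps | 0 < eps /\ varpi eps zeta = set0].

Definition eps2 (R : realType) (zeta : R) : R :=
  sup [set eps | 0 < eps /\ countable (varpi eps zeta)].

(* The infinite product is the limit of its partial products, so it carries
   the intended meaning only where these converge, e.g. for |z| < 1. *)
Definition E (R : realType) (z : R) : R :=
  (1 - (1 - z) *
     lim ((fun N : nat => \prod_(0 <= m < N) (1 - z ^+ (2 ^ m)%N)) @ \oo))
  / (2 * z).

(* tau(p/q), for p/q already in lowest terms. *)
Definition tau (R : realType) (p q : nat) : R := E (q%:R / p%:R) / p%:R.

(* Main.v *)
Require Import Defs.
From mathcomp Require Import all_boot all_order all_algebra.
From mathcomp Require Import all_classical all_reals all_analysis.
From mathcomp Require Import ring lra zify.
Import Order.TTheory GRing.Theory Num.Theory.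
Import numFieldNormedType.Exports.
Local Open Scope classical_set_scope.
Local Open Scope ring_scope.

(** Write [alpha zeta^n = u_n + e_n] with [u_n] the nearest integer. Then
    [s_n = q u_{n+1} - p u_n = p e_n - q e_{n+1}] is an integer.

    Lower bounds. If [eps < q/(2(p+q))] then [2|s_n| < q], so [u_n] determines
    [s_n], hence [u_{n+1}] and finally [alpha]. For [tau]: with [z = q/p] the
    numbers [F_n = p e_n] satisfy [F_n = s_n + z F_{n+1}], and [|F_n| < 1] forces
    the nonzero [s_n] to be [1] and [-1] alternately. If moreover
    [|F_n| <= eps < E z], the sign word of [F] splits eventually into blocks [01]
    and [10], and the first letters of the blocks give a word of the same kind
    for [z^2] and some [eps'] with a larger gap [E (z^2) - eps'], by
    [E z = (1 + (1-z) z E (z^2)) / (1+z)]. As [E <= 1], this cannot be iterated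
    forever unless [s] is eventually periodic, which would make [u] bounded.

    Upper bounds. Any integer sequence [u] with [|q u_{n+1} - p u_n| <= M] is
    followed by some [alpha zeta^n] up to [M/(p-q)]. Minimal residues bound
    [eps1]; for [eps2] there are two residues of size at most [q-1] whenever [q]
    does not divide [p u_n], and this choice is used to avoid a given
    enumeration. *)

(** * Thue-Morse bound *)

Definition partial_prod (R : realType) (z : R) (N : nat) : R :=
  \prod_(0 <= m < N) (1 - z ^+ (2 ^ m)%N).

Lemma partial_prodS (R : realType) (z : R) (N : nat) :
  partial_prod R z N.+1 = (1 - z) * partial_prod R (z ^+ 2) N.
Proof.
rewrite /partial_prod big_nat_recl //= expn0 expr1; congr (_ * _).
by apply: eq_bigr => m _; rewrite -exprM -expnS.
Qed.

Lemma sqr_itv01 (R : realType) (z : R) : 0 < z < 1 -> 0 < z ^+ 2 < 1.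
Proof. by move=> z01; apply/andP; split; nra. Qed.

Lemma partial_prod_ge0 (R : realType) (z : R) (N : nat) :
  0 < z < 1 -> 0 <= partial_prod R z N.
Proof.
move=> /andP[z0 z1]; apply: prodr_ge0 => m _.
by rewrite subr_ge0 exprn_ile1 // ltW.
Qed.

Lemma cvg_partial_prod (R : realType) (z : R) :
  0 < z < 1 -> cvgn (partial_prod R z).
Proof.
move=> z01; apply: nonincreasing_is_cvgn.
  apply/nonincreasing_seqP => n.
  rewrite [leLHS]/partial_prod big_nat_recr //=.
  rewrite ler_piMr ?partial_prod_ge0 // gerBl exprn_ge0 //.
  by case/andP: z01 => /ltW.
by exists 0 => _ [n _ <-]; apply: partial_prod_ge0.
Qed.

(** The form [1 - 2 * z] is stable under passing from [z ^+ 2] to [z]: the bound given by induction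
    exceeds it by [2 * z ^+ 3 / (1 + z)]. In the limit this is exactly [E z <= 1]. *)
Lemma partial_prod_lower (R : realType) (z : R) (N : nat) :
  0 < z < 1 -> 1 - 2 * z <= (1 - z) * partial_prod R z N.
Proof.
elim: N z => [|N IH] z z01.
  by rewrite /partial_prod big_geq // mulr1; lra.
have := IH _ (sqr_itv01 R z z01); rewrite partial_prodS.
have := partial_prod_ge0 R _ N (sqr_itv01 R z z01).
move: (partial_prod _ _ _) => d d0 hd.
have z0 : 0 < z by case/andP: z01.
have -> : (1 - z) * ((1 - z) * d) =
    (1 - z) / (1 + z) * ((1 - z ^+ 2) * d) by field; lra.
rewrite mulrAC ler_pdivlMr; last by lra.
have h : (1 - z) * (1 - 2 * z ^+ 2) <= (1 - z) * ((1 - z ^+ 2) * d).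
  by rewrite ler_wpM2l //; lra.
apply: le_trans h; rewrite -subr_ge0.
have -> : (1 - z) * (1 - 2 * z ^+ 2) - (1 - 2 * z) * (1 + z) = 2 * z ^+ 3.
  by ring.
by rewrite mulr_ge0 // exprn_ge0 // ltW.
Qed.

Lemma E_le1 (R : realType) (z : R) : 0 < z < 1 -> E z <= 1.
Proof.
move=> z01; have z0 : 0 < z by case/andP: z01.
rewrite /E -/(partial_prod R z) ler_pdivrMr ?mul1r; last by lra.
suff : (1 - 2 * z) / (1 - z) <= lim (partial_prod R z @ \oo).
  by rewrite ler_pdivrMr; lra.
apply: limr_ge; first exact: cvg_partial_prod.
apply: nearW => N; rewrite ler_pdivrMr; last by lra.
by rewrite [leRHS]mulrC; apply: partial_prod_lower.
Qed.

(** Splitting off the factor [m = 0] leaves the product at [z ^+ 2]; this drives the renormalisation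
    from [z] to [z ^+ 2]. *)
Lemma E_rec (R : realType) (z : R) : 0 < z < 1 ->
  E z = (1 + (1 - z) * z * E (z ^+ 2)) / (1 + z).
Proof.
move=> z01; have z0 : 0 < z by case/andP: z01.
have -> : E z = (1 - (1 - z) * ((1 - z) *
    lim (partial_prod R (z ^+ 2) @ \oo))) / (2 * z).
  rewrite /E -/(partial_prod R z); congr ((1 - _ * _) / _).
  apply: cvg_lim => //; rewrite -cvg_shiftS /=.
  under eq_fun do rewrite partial_prodS.
  by apply: cvgMr; apply: cvg_partial_prod; apply: sqr_itv01.
rewrite /E -/(partial_prod R (z ^+ 2)).
by field; lra.
Qed.

(** * Eventually periodic words *)

Definition eventually_periodic (T : Type) (s : nat -> T) : Prop :=
  exists N t : nat, (0 < t)%N /\ forall n, (N <= n)%N -> s (n + t)%N = s n.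

(** A word without a descent is nondecreasing, hence eventually constant. *)
Lemma exists_descent (d : nat -> bool) :
  ~ eventually_periodic bool d -> exists n, d n && ~~ d n.+1.
Proof.
move=> hper; apply/not_existsP => hn; apply: hper.
have hd n : d n -> d n.+1.
  by move=> dn; apply: contraT => dn1; case: (hn n); rewrite dn.
have [[N dN]|nd] := pselect (exists N, d N).
  have dall m : d (N + m)%N by elim: m => [|m]; rewrite ?addn0 ?addnS //; exact: hd.
  exists N, 1%N; split => // m Nm.
  by rewrite -(subnKC Nm) -addnA !dall.
have d0 i : d i = false by apply/negP => di; apply: nd; exists i.
by exists 0%N, 1%N; split => // m _; rewrite !d0.
Qed.

Lemma eventually_periodic_of_odd (d : nat -> bool) (c : nat) :
  (forall j, d (c + j.*2)%N) ->
  eventually_periodic bool (fun j => ~~ d (c + j.*2).+1) ->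
  eventually_periodic bool d.
Proof.
move=> dA [N [t [t0 ht]]].
exists (c + N.*2)%N, t.*2; split; first by rewrite double_gt0.
move=> m hm; have [i Ni ->] : exists2 i, (N.*2 <= i)%N & m = (c + i)%N.
  by exists (m - c)%N; lia.
have hN : (N <= i./2)%N by rewrite -(doubleK N) half_leq.
rewrite -(odd_double_half i).
case: (odd i) => /=; rewrite ?add1n ?add0n -addnA.
  by rewrite addSn -doubleD !addnS; apply: negb_inj; exact: ht.
by rewrite -doubleD !dA.
Qed.

(* The gap [E z - eps] at least doubles when [z] is replaced by [z ^+ 2]. *)
Lemma alternating_word_bound (R : realType) (k : nat) (z eps : R)
    (d : nat -> bool) (G : nat -> R) :
  0 < z < 1 -> 1 < 2 ^+ k * (E z - eps) ->
  (forall n, G n = if d n then 1 - z * G n.+1 else z * G n.+1) ->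
  (forall n, 0 <= G n <= eps) -> ~ eventually_periodic bool d -> False.
Proof.
elim: k z eps d G => [|k IH] z eps d G z01 hgap hG hb hper.
  (* With [k = 0] the gap exceeds 1, against [E z <= 1] and [0 <= eps]. *)
  have := E_le1 R z z01; have := hb 0%N => /andP[? ?].
  by move: hgap; rewrite expr0 mul1r; lra.
have z0 : 0 < z by case/andP: z01.
have z1 : z < 1 by case/andP: z01.
set y := (1 - z) * z; have y0 : 0 < y by rewrite mulr_gt0 //; lra.
have E2le := E_le1 R _ (sqr_itv01 R z z01).
have Erec : E z * (1 + z) = 1 + y * E (z ^+ 2).
  by rewrite (E_rec R z z01) divfK //; lra.
have yE : y * E (z ^+ 2) <= y by rewrite ler_piMr // ltW.
have eps_E : eps < E z.
  by rewrite -subr_gt0 -(pmulr_rgt0 _ (exprn_gt0 k.+1 (ltr0n R 2))); lra.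
have epsz : eps * (1 + z) < 1 + y.
  apply: lt_le_trans (_ : E z * (1 + z) <= _); first by rewrite ltr_pM2r //; lra.
  by lra.
have eps0 : 0 <= eps by have /andP[? ?] := hb 0%N; lra.
have eps3 : eps * (1 + z ^+ 3) < 1.
  have -> : 1 + z ^+ 3 = (1 + z) * (1 - y) by rewrite /y; ring.
  rewrite mulrA; have h : eps * (1 + z) * (1 - y) < (1 + y) * (1 - y).
    by rewrite ltr_pM2r // /y; nra.
  by apply: lt_le_trans h _; nra.
(* [A] is the lower bound that letters 1, 0 at [n], [n.+1] force on [G n.+2]. By [A1], a value at
   least [A] carries the letter 1. By [A2], it is at or above the fixed point [1 / (1 + z)] of the
   map [x -> 1 - z + z^2 x] of a block 11, whose inverse expands; so the bound [A] persists in steps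
   of two. *)
pose A := (1 - eps) / z ^+ 2.
have z20 : 0 < z ^+ 2 by rewrite exprn_gt0.
have A1 : z * eps < A by rewrite ltr_pdivlMr //; lra.
have A2 : 1 <= (1 + z) * A.
  by rewrite mulrA ler_pdivlMr //; move: epsz; rewrite /y; lra.
have start n : d n -> ~~ d n.+1 -> A <= G n.+2.
  move=> dn /negbTE dn1; have /andP[_ ] := hb n.
  by rewrite hG dn hG dn1 ler_pdivrMr //; lra.
have stepd n : A <= G n -> d n.
  move=> hA; apply: contraT => /negbTE dn; move: hA; rewrite hG dn.
  have /andP[_ h] := hb n.+1.
  have : z * G n.+1 <= z * eps by rewrite ler_pM2l.
  by lra.
have step n : A <= G n -> A <= G n.+2.
  move=> hA; have dn := stepd _ hA.
  have [dn1|dn1] := boolP (d n.+1); last exact: start.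
  move: hA; rewrite hG dn hG dn1 => hA.
  rewrite -(ler_pM2l z20); have : A * z ^+ 2 = 1 - eps by rewrite divfK ?gt_eqF.
  have : (1 - z) * 1 <= (1 - z) * ((1 + z) * A) by rewrite ler_pM2l //; lra.
  by lra.
have [n /andP[dn dn1]] := exists_descent d hper.
pose c := n.+2.
have GA j : A <= G (c + j.*2)%N.
  elim: j => [|j IHj]; first by rewrite addn0; exact: start.
  by rewrite doubleS !addnS; exact: step.
have dA j := stepd _ (GA j).
(* Affine change sending the fixed point of the block 11 to 0, scaled so that a block 10 acts as
   [x -> 1 - z^2 x]. *)
pose G' j := ((1 + z) * G (c + j.*2)%N - 1) / y.
pose eps' := ((1 + z) * eps - 1) / y.
have yG j : y * G' j = (1 + z) * G (c + j.*2)%N - 1.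
  by rewrite /G' mulrCA mulfV ?gt_eqF // mulr1.
have yeps : y * eps' = (1 + z) * eps - 1.
  by rewrite /eps' mulrCA mulfV ?gt_eqF // mulr1.
(* When [d] records the changes of a sign word, the letters 1 at [c + j.*2] cut it into blocks 01
   and 10, and the negated odd letters are the changes between first letters of blocks. *)
apply: (IH (z ^+ 2) eps' (fun j => ~~ d (c + j.*2).+1) G').
- exact: sqr_itv01.
- have h : (1 + z) * (E z - eps) = y * (E (z ^+ 2) - eps') by lra.
  have hk : 0 < 2 ^+ k :> R by rewrite exprn_gt0.
  apply: lt_le_trans hgap _; rewrite exprSr -mulrA ler_pM2l //.
  rewrite -(ler_pM2l y0) -h mulrA ler_pM2r ?subr_gt0 // /y.
  by nra.
- move=> j; apply: (mulfI (lt0r_neq0 y0)); rewrite yG [in LHS]hG dA hG.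
  have := yG j.+1; rewrite doubleS !addnS; case: (d _) => /= h.
    have -> : y * (z ^+ 2 * G' j.+1) = z ^+ 2 * (y * G' j.+1) by ring.
    by rewrite h; ring.
  have -> : y * (1 - z ^+ 2 * G' j.+1) = y - z ^+ 2 * (y * G' j.+1) by ring.
  by rewrite h /y; ring.
- move=> j; have /andP[h1 h2] := hb (c + j.*2)%N.
  rewrite -[0 <= _](ler_pM2l y0) -[G' j <= _](ler_pM2l y0) mulr0 yG yeps.
  apply/andP; split.
    have : (1 + z) * A <= (1 + z) * G (c + j.*2)%N by rewrite ler_pM2l //; lra.
    by lra.
  by rewrite lerB // ler_pM2l //; lra.
- by move=> hd'; apply: hper; apply: (eventually_periodic_of_odd d c).
Qed.

(** [|s n| <= eps + z * eps < 2] leaves the digits -1, 0, 1. Digit 1 forces [F n > 0 > F n.+1],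
    digit -1 the reverse, and digit 0 preserves the sign. *)
Lemma alternating_of_bounded (R : realType) (z eps : R) (s : nat -> int)
    (F : nat -> R) :
  0 < z < 1 -> eps < 1 ->
  (forall n, F n = (s n)%:~R + z * F n.+1) -> (forall n, `|F n| <= eps) ->
  forall n, s n = (0 < F n)%R%:Z - (0 < F n.+1)%R%:Z /\
    `|F n| = if (0 < F n) != (0 < F n.+1) then 1 - z * `|F n.+1|
             else z * `|F n.+1|.
Proof.
move=> /andP[z0 z1] eps1 hF hb n.
have := hb n; have := hb n.+1; rewrite !ler_norml => /andP[a1 a2] /andP[b1 b2].
have hs := hF n.
have zlo : z * - eps <= z * F n.+1 by rewrite ler_pM2l.
have zhi : z * F n.+1 <= z * eps by rewrite ler_pM2l.
have zeps : z * eps < 1 by nra.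
have : -2 < s n < 2 by rewrite -!(ltr_int R) /=; apply/andP; split; lra.
move=> hs2; have {hs2} : s n = 0 \/ s n = 1 \/ s n = -1 by clear -hs2; lia.
case=> [s0|[s1|s1]].
- move: hs; rewrite s0 add0r => hs.
  by rewrite [in 0 < F n]hs pmulr_rgt0 // subrr eqxx hs normrM gtr0_norm.
- move: hs; rewrite s1 => hs.
  have h1 : F n.+1 < 0 by rewrite -(pmulr_rlt0 _ z0); lra.
  have h0 : 0 < F n by lra.
  by rewrite h0 (lt_gtF h1) /= (gtr0_norm h0) (ltr0_norm h1) hs; split=> //; ring.
- move: hs; rewrite s1 => hs.
  have h1 : 0 < F n.+1 by rewrite -(pmulr_rgt0 _ z0); lra.
  have h0 : F n < 0 by lra.
  by rewrite h1 (lt_gtF h0) /= (ltr0_norm h0) (gtr0_norm h1) hs; split=> //; ring.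
Qed.

(** Over one period of the change word, [x] is either repeated or complemented, so twice that period
    works in both cases. *)
Lemma eventually_periodic_of_change (x : nat -> bool) :
  eventually_periodic bool (fun n => x n != x n.+1) ->
  eventually_periodic bool x.
Proof.
move=> [N [t [t0 ht]]].
have h m : (x (N + m + t)%N != x (N + m)%N) = (x (N + t)%N != x N).
  elim: m => [|m <-]; first by rewrite addn0.
  have := ht (N + m)%N (leq_addr _ _); rewrite !addnS addSn.
  by case: (x _); case: (x _); case: (x _); case: (x _).
exists N, (t + t)%N; split; first by rewrite addn_gt0 t0.
move=> n Nn; have := h (n - N)%N; have := h (n - N + t)%N.
rewrite !addnA subnKC // => <-.
by case: (x _); case: (x _); case: (x _).
Qed.

Lemma eventually_periodic_of_bounded (R : realType) (z eps : R)
    (s : nat -> int) (F : nat -> R) :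
  0 < z < 1 -> eps < E z ->
  (forall n, F n = (s n)%:~R + z * F n.+1) -> (forall n, `|F n| <= eps) ->
  eventually_periodic int s.
Proof.
move=> z01 epsE hF hb.
have eps1 : eps < 1 := lt_le_trans epsE (E_le1 R z z01).
have hs := alternating_of_bounded R z eps s F z01 eps1 hF hb.
apply: contrapT => hper.
have [k hk] : exists k, 1 < 2 ^+ k * (E z - eps).
  have gap : 0 < E z - eps by rewrite subr_gt0.
  exists (Num.bound (E z - eps)^-1).
  rewrite -ltr_pdivrMr // mul1r.
  by apply: Num.Theory.upper_nthrootP; exact: leqnn.
apply: (alternating_word_bound R k z eps (fun n => (0 < F n) != (0 < F n.+1))
  (fun n => `|F n|)) => //.
- by move=> n; case: (hs n).
- by move=> n; rewrite normr_ge0 hb.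
move=> hd; apply: hper.
have [N [t [t0 ht]]] := eventually_periodic_of_change (fun n => 0 < F n) hd.
exists N, t; split => // n Nn.
have [-> _] := hs (n + t)%N; have [-> _] := hs n.
by rewrite -addSn !ht // ltnW.
Qed.

(** * Orbits modulo one *)

Lemma exprn_unbounded (R : realType) (x B : R) :
  1 < x -> exists n, forall m, (n <= m)%N -> B < x ^+ m.
Proof.
move=> x1; have x0 : 0 < x - 1 by rewrite subr_gt0.
have bern n : n%:R * (x - 1) < x ^+ n.
  elim: n => [|n IH]; first by rewrite mul0r expr0.
  have h1 : 1 <= x ^+ n by rewrite exprn_ege1 // ltW.
  rewrite exprSr -natr1.
  have : (x - 1) * 1 <= (x - 1) * x ^+ n by rewrite ler_pM2l.
  by lra.
exists (Num.bound (`|B| / (x - 1))) => m hm.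
apply: le_lt_trans (ler_norm B) _; apply: lt_le_trans (_ : m%:R * (x - 1) <= _).
  rewrite -ltr_pdivrMr //; apply: lt_le_trans (archi_boundP _) _.
    by rewrite divr_ge0 // ltW.
  by rewrite ler_nat.
exact/ltW/bern.
Qed.

(** Iterating gives [q^n v_n = p^n v_0], so by coprimality every power of [q] divides [v 0]; the
    exponent [|v 0|] is already too large. *)
Lemma iter_div_eq0 (p q : nat) (v : nat -> int) :
  (2 <= q)%N -> coprime p q ->
  (forall n, q%:Z * v n.+1 = p%:Z * v n) -> v 0%N = 0.
Proof.
move=> hq hcop hv.
have h n : q%:Z ^+ n * v n = p%:Z ^+ n * v 0%N.
  elim: n => [|n IH]; first by rewrite !expr0.
  by rewrite exprSr -mulrA hv mulrCA IH exprS mulrA.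
apply/eqP; rewrite -absz_eq0; apply: contraT; rewrite -lt0n => v0.
have : (q ^ `|v 0%N| %| `|v 0%N|)%N.
  rewrite -(@Gauss_dvdr _ (p ^ `|v 0%N|)); last first.
    by rewrite coprimeXl // coprimeXr // coprime_sym.
  have := congr1 absz (h `|v 0%N|%N); rewrite !abszM !abszX !absz_nat => <-.
  exact: dvdn_mulr.
move=> /(dvdn_leq v0); rewrite leqNgt ltn_expl //.
Qed.

Lemma dist_int_le (R : realType) (x : R) (k : int) :
  dist_int x <= `|x - k%:~R|.
Proof. by apply: ge_inf; [exists 0 => _ [j _ <-] | exists k]. Qed.

Lemma dist_int_lt (R : realType) (x e : R) :
  dist_int x < e -> exists k : int, `|x - k%:~R| < e.
Proof.
case/inf_lt; first by exists `|x - 0%:~R|; exists 0.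
by move=> _ [k _ <-] hk; exists k.
Qed.

Lemma nearest_int (R : realType) (x : R) : exists k : int, `|x - k%:~R| <= 1 / 2.
Proof.
exists (Num.floor (x + 1 / 2)); have /andP[] := floor_itv (x + 1 / 2).
by rewrite intrD ler_norml => *; apply/andP; split; lra.
Qed.

Lemma zeta_gt1 (R : realType) (p q : nat) :
  (0 < q < p)%N -> 1 < p%:R / q%:R :> R.
Proof. by case/andP=> q0 qp; rewrite ltr_pdivlMr ?ltr0n // mul1r ltr_nat. Qed.

(** [dist_int] is an infimum; the room between [eps] and [eps'] yields actual integers. *)
Lemma varpi_orbit (R : realType) (zeta eps eps' alpha : R) :
  eps < eps' -> varpi eps zeta alpha ->
  exists (N : nat) (u : nat -> int),
    forall n, `|alpha * zeta ^+ (N + n) - (u n)%:~R| < eps'.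
Proof.
move=> lt_eps [_ [n0 hn0]].
have h n : exists k : int, `|alpha * zeta ^+ (`|n0| + n) - k%:~R| < eps'.
  apply: dist_int_lt; apply: le_lt_trans lt_eps.
  by apply: (hn0 (Posz (`|n0| + n))); lia.
by have [u hu] := choice h; exists `|n0|%N, u.
Qed.

Lemma orbit_residue (R : realType) (p q : nat) (x : R) (u : nat -> int)
    (m n : nat) : (0 < q)%N ->
  (q%:Z * u n.+1 - p%:Z * u n)%:~R =
  p%:R * (x * (p%:R / q%:R) ^+ (m + n) - (u n)%:~R) -
  q%:R * (x * (p%:R / q%:R) ^+ (m + n).+1 - (u n.+1)%:~R) :> R.
Proof.
move=> q0; have q0' : q%:R != 0 :> R by rewrite pnatr_eq0 -lt0n.
rewrite exprSr intrB !intrM -!pmulrn.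
by field.
Qed.

Lemma varpi_below_tau (R : realType) (p q : nat) (eps : R) :
  (q < p)%N -> (2 <= q)%N -> coprime p q ->
  eps < tau R p q -> varpi eps (p%:R / q%:R) = set0.
Proof.
move=> hpq hq hcop heps; apply/seteqP; split => // alpha halpha.
have p0 : 0 < p%:R :> R by rewrite ltr0n; apply: leq_ltn_trans hpq.
have q0 : 0 < q%:R :> R by rewrite ltr0n; apply: leq_trans hq.
have zeta1 : 1 < p%:R / q%:R :> R by apply: zeta_gt1; rewrite hpq andbT ltnW.
have [eps' eps1 eps2] : exists2 e, eps < e & e < tau R p q.
  by exists ((eps + tau R p q) / 2); lra.
have alpha0 : alpha != 0 by case: halpha.
have [M [u hu]] := varpi_orbit _ _ _ _ _ eps1 halpha.
pose F n := p%:R * (alpha * (p%:R / q%:R) ^+ (M + n) - (u n)%:~R).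
have : eventually_periodic int (fun n => q%:Z * u n.+1 - p%:Z * u n).
  apply: (eventually_periodic_of_bounded R (q%:R / p%:R) (p%:R * eps') _ F).
  - by rewrite divr_gt0 //= ltr_pdivrMr // mul1r ltr_nat.
  - by rewrite mulrC -ltr_pdivlMr.
  - move=> n; rewrite (orbit_residue R p q alpha u M) ?(ltnW hq) //.
    by rewrite /F addnS mulrA divfK ?gt_eqF //; ring.
  - by move=> n; rewrite /F normrM gtr0_norm // ler_pM2l // ltW.
case=> N [t [t0 ht]].
(* The period of the residues passes to [u]: the difference [v] between [u] and its shift satisfies
   [q v_(i+1) = p v_i], hence vanishes. *)
have hper n : (N <= n)%N -> u (n + t)%N = u n.
  move=> Nn; apply/eqP; rewrite -subr_eq0; apply/eqP.
  pose v i := u (n + i + t)%N - u (n + i)%N.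
  suff : v 0%N = 0 by rewrite /v addn0.
  apply: (iter_div_eq0 p q) => // i.
  have := ht (n + i)%N (leq_trans Nn (leq_addr _ _)).
  by rewrite /v !addnS !addSn !mulrBr; lra.
have hperk k : u (N + k * t)%N = u N.
  by elim: k => [|k IH]; rewrite ?addn0 // mulSn addnC -addnA addnC hper ?leq_addl // addnC.
(* [u] returns to [u N] forever, while [|alpha| * zeta^n] is unbounded. *)
have [n hn] := exprn_unbounded R _ ((`|(u N)%:~R| + eps') / `|alpha|) zeta1.
have := hn (M + (N + n * t))%N; rewrite ltr_pdivrMr ?normr_gt0 //.
have ndvd : (n <= M + (N + n * t))%N.
  by rewrite addnA; apply: leq_trans (leq_addl _ _); exact: leq_pmulr.
move=> /(_ ndvd); have := hu (N + n * t)%N; rewrite hperk.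
have pow0 : 0 < (p%:R / q%:R) ^+ (M + (N + n * t)) :> R.
  by rewrite exprn_gt0 // divr_gt0.
rewrite -[X in X * `|alpha|](gtr0_norm pow0) -normrM mulrC.
move: (_ * alpha) => X h1.
have := ler_normD (X - (u N)%:~R) (u N)%:~R; rewrite subrK => h2 h3.
by lra.
Qed.

(** The starting index and the first integer determine [alpha]. Two residues below [q / 2] in size
    that differ by a multiple of [q] are equal, which fixes each next integer; and two orbits near
    the same integers stay within [2 * eps'] of each other, so they coincide. *)
Lemma varpi_countable (R : realType) (p q : nat) (eps eps' : R) :
  (q < p)%N -> (0 < q)%N -> eps < eps' ->
  (forall s : int, `|s%:~R| < (p%:R + q%:R) * eps' -> 2 * `|s| < q%:Z) ->
  countable (varpi eps (p%:R / q%:R)).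
Proof.
move=> hpq q0 lt_eps hsmall.
have zeta1 : 1 < p%:R / q%:R :> R by apply: zeta_gt1; rewrite q0.
have zeta0 : 0 < p%:R / q%:R :> R by apply: lt_trans zeta1.
pose code alpha (c : nat * int) := exists u : nat -> int, u 0%N = c.2 /\
  forall n, `|alpha * (p%:R / q%:R) ^+ (c.1 + n) - (u n)%:~R| < eps'.
have hcode alpha : exists c, varpi eps (p%:R / q%:R) alpha -> code alpha c.
  have [h|h] := pselect (varpi eps (p%:R / q%:R) alpha); last by exists (0%N, 0).
  have [N [u hu]] := varpi_orbit _ _ _ _ _ lt_eps h.
  by exists (N, u 0%N) => _; exists u.
have [f hf] := choice hcode.
apply/countable_injP; exists (fun alpha => choice.pickle (f alpha)).
move=> a b /set_mem/hf [u [u0 hu]] /set_mem/hf [v [v0 hv]] /(pcan_inj choice.pickleK) fab.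
rewrite -fab in v0 hv.
have small (x : R) (w : nat -> int) n :
    (forall n, `|x * (p%:R / q%:R) ^+ ((f a).1 + n) - (w n)%:~R| < eps') ->
    2 * `|q%:Z * w n.+1 - p%:Z * w n| < q%:Z.
  move=> hw; apply: hsmall; rewrite (orbit_residue R p q x w (f a).1) //.
  have hp : 0 < p%:R :> R by rewrite ltr0n (leq_ltn_trans _ hpq).
  have hq : 0 < q%:R :> R by rewrite ltr0n.
  rewrite mulrDl; apply: le_lt_trans (ler_normB _ _) _; rewrite !normrM.
  rewrite ![`|_%:R|]gtr0_norm //; apply: ltrD; rewrite ltr_pM2l //.
  by rewrite -addnS.
have uv n : u n = v n.
  elim: n => [|n IH]; first by rewrite u0 v0.
  have := small _ _ n hu; have := small _ _ n hv; rewrite IH.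
  have hqz : 0 < q%:Z by [].
  move=> h1 h2; apply/eqP; rewrite -subr_eq0.
  have : `|q%:Z * (u n.+1 - v n.+1)| < q%:Z.
    by rewrite mulrBr; lia.
  by rewrite normrM gtr0_norm // gtr_pMr //; lia.
apply/eqP; rewrite -subr_eq0; apply: contraT => ab0.
have [n hn] := exprn_unbounded R _ (2 * eps' / `|a - b|) zeta1.
have := hn ((f a).1 + n)%N (leq_addl _ _).
rewrite ltr_pdivrMr ?normr_gt0 //.
have pow0 : 0 < (p%:R / q%:R) ^+ ((f a).1 + n) :> R by rewrite exprn_gt0.
rewrite -[X in X * `|a - b|](gtr0_norm pow0) -normrM [_ * (a - b)]mulrC mulrBl.
have := hu n; have := hv n; rewrite uv !ltr_norml ltr_normr.
by move=> /andP[? ?] /andP[? ?] /orP[]; lra.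
Qed.

(** * Suprema of thresholds *)

Lemma sup_ge (R : realType) (S : set R) (t b : R) :
  (forall x, S x -> 0 <= x <= b) -> (forall x, 0 < x < t -> S x) -> t <= sup S.
Proof.
move=> hS ht.
have hub : has_ubound S by exists b => x /hS/andP[].
(* The empty set has supremum 0, so this holds in all cases; it makes the midpoint used below
   positive. *)
have sup0 : 0 <= sup S.
  have [[x Sx]|S0] := pselect (S !=set0); last by rewrite sup_out // => -[/S0].
  have /andP[x0 _] := hS x Sx.
  by apply: le_trans x0 _; apply: ub_le_sup.
rewrite leNgt; apply/negP => lt_t.
have : (sup S + t) / 2 <= sup S by apply: ub_le_sup => //; apply: ht; lra.
by lra.
Qed.

Lemma sup_le (R : realType) (S : set R) (b : R) :
  0 <= b -> (forall x, S x -> x <= b) -> sup S <= b.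
Proof.
move=> b0 hS; have [[x Sx]|S0] := pselect (S !=set0).
  by apply: ge_sup => //; exists x.
by rewrite sup_out // => -[/S0].
Qed.

(** * Shadowing integer sequences *)

(** Division by [zeta ^+ n] makes the intervals nested, and the supremum of the left ends is a
    common point. *)
Lemma nested_scaled_itv (R : realType) (zeta : R) (lo hi : nat -> R) :
  0 < zeta -> (forall n, lo n <= hi n) ->
  (forall n, zeta * lo n <= lo n.+1) -> (forall n, hi n.+1 <= zeta * hi n) ->
  exists alpha, forall n, lo n <= alpha * zeta ^+ n <= hi n.
Proof.
move=> z0 hlh hlo hhi.
have pow0 n : 0 < zeta ^+ n by rewrite exprn_gt0.
pose a n := lo n / zeta ^+ n; pose b n := hi n / zeta ^+ n.
have ab n : a n <= b n by rewrite ler_pM2r // invr_gt0.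
have a_mono : {homo a : m n / (m <= n)%N >-> m <= n}.
  apply/nondecreasing_seqP => n; rewrite ler_pdivrMr //.
  by rewrite /a exprS invfM -!mulrA mulVf ?gt_eqF // mulr1 mulrC ler_pdivlMl.
have b_mono : {homo b : m n / (m <= n)%N >-> n <= m}.
  apply/nonincreasing_seqP => n; rewrite ler_pdivlMr //.
  by rewrite /b exprS invfM -!mulrA mulVf ?gt_eqF // mulr1 mulrC ler_pdivrMl.
have amb m n : a m <= b n.
  apply: le_trans (a_mono _ _ (leq_maxl m n)) _.
  by apply: le_trans (ab _) (b_mono _ _ (leq_maxr m n)).
exists (sup (range a)) => n; apply/andP; split.
  rewrite -ler_pdivrMr //; apply: ub_le_sup; last by exists n.
  by exists (b 0%N) => _ [m _ <-].
rewrite -ler_pdivlMr //.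
by apply: ge_sup; [exists (a 0%N), 0%N | move=> _ [m _ <-]; exact: (amb m n)].
Qed.

Lemma shadowing (R : realType) (p q : nat) (M : R) (u : nat -> int) :
  (0 < q < p)%N ->
  (forall n, `|(q%:Z * u n.+1 - p%:Z * u n)%:~R| <= M) ->
  exists alpha : R, forall n,
    `|alpha * (p%:R / q%:R) ^+ n - (u n)%:~R| <= M / (p%:R - q%:R).
Proof.
move=> /andP[q0 qp] hu.
have q0' : 0 < q%:R :> R by rewrite ltr0n.
have pq : 0 < p%:R - q%:R :> R by rewrite subr_gt0 ltr_nat.
(* The radius solves [p delta - q delta = M], which makes the intervals of radius [delta] about
   [u n] nested after scaling. *)
pose delta := M / (p%:R - q%:R).
have dM : p%:R * delta - q%:R * delta = M.
  by rewrite -mulrBl mulrC divfK ?gt_eqF.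
have M0 : 0 <= M by apply: le_trans (hu 0%N).
have d0 : 0 <= delta by rewrite divr_ge0 // ltW.
have [alpha h] : exists alpha, forall n,
    (u n)%:~R - delta <= alpha * (p%:R / q%:R) ^+ n <= (u n)%:~R + delta.
  apply: nested_scaled_itv.
  - by rewrite divr_gt0 // ltr0n (ltn_trans q0).
  - by move=> n; lra.
  - move=> n; rewrite mulrAC ler_pdivrMr //.
    by have := hu n; rewrite intrB !intrM -!pmulrn ler_norml => /andP[? ?]; lra.
  - move=> n; rewrite mulrAC ler_pdivlMr //.
    by have := hu n; rewrite intrB !intrM -!pmulrn ler_norml => /andP[? ?]; lra.
exists alpha => n; have := h n; rewrite -/delta ler_norml => /andP[? ?].
by apply/andP; split; lra.
Qed.

Lemma varpi_intro (R : realType) (zeta eps alpha : R) (u : nat -> int) :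
  alpha != 0 -> (forall n, `|alpha * zeta ^+ n - (u n)%:~R| <= eps) ->
  varpi eps zeta alpha.
Proof.
move=> a0 h; split => //; exists 0 => -[n _|//].
exact: le_trans (dist_int_le R _ (u n)) (h n).
Qed.

Lemma varpi_full (R : realType) (zeta eps alpha : R) :
  1 / 2 <= eps -> alpha != 0 -> varpi eps zeta alpha.
Proof.
move=> heps a0; have [u hu] := choice (fun n => nearest_int R (alpha * zeta ^+ n)).
by apply: (varpi_intro _ _ _ _ u) => // n; apply: le_trans (hu n) heps.
Qed.

Lemma varpi_neq0 (R : realType) (p q : nat) (M eps : R) :
  (0 < q < p)%N ->
  (forall a : int, exists b : int, `|(q%:Z * b - p%:Z * a)%:~R| <= M) ->
  M / (p%:R - q%:R) <= eps -> varpi eps (p%:R / q%:R) <> set0.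
Proof.
move=> hpq hstep heps.
have [g hg] := choice hstep.
(* Starting above [eps] rules out [alpha = 0] already at [n = 0]. *)
pose u0 := Num.floor eps + 1; pose u n := iter n g u0.
have [alpha hal] := shadowing R p q M u hpq (fun n => hg (u n)).
have {}hal n := le_trans (hal n) heps.
have : varpi eps (p%:R / q%:R) alpha.
  apply: (varpi_intro _ _ _ _ u) => //; apply/eqP => a0.
  have := hal 0%N; rewrite a0 mul0r sub0r normrN.
  rewrite leNgt => /negP; apply.
  exact: lt_le_trans (floorD1_gt eps) (ler_norm _).
by move=> h h0; rewrite h0 in h.
Qed.

Lemma nearest_step (p q : nat) (a : int) :
  (0 < q)%N -> exists b : int, 2 * `|q%:Z * b - p%:Z * a| <= q%:Z.
Proof.
(* The witness is the floor of [c / q + 1/2], an integer nearest to [c / q]. *)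
move=> q0; move: (p%:Z * a) => c; exists ((2 * c + q%:Z) %/ (2 * q%:Z))%Z.
have q2 : 0 < 2 * q%:Z by lia.
have := divz_eq (2 * c + q%:Z) (2 * q%:Z).
have := ltz_pmod (2 * c + q%:Z) q2.
have := modz_ge0 (2 * c + q%:Z) (lt0r_neq0 q2).
by move: (divz _ _) (modz _ _) => b r; nia.
Qed.

(** * Uncountability by avoidance *)

Lemma varpi_avoid (R : realType) (p q : nat) (f : nat -> R) :
  (q < p)%N -> (2 <= q)%N -> coprime p q ->
  (q%:R - 1) / (p%:R - q%:R) < 1 / 2 :> R ->
  exists alpha : R,
    varpi ((q%:R - 1) / (p%:R - q%:R)) (p%:R / q%:R) alpha /\
    forall k, alpha <> f k.
Proof.
move=> hpq hq hcop; set delta := (X in X < _) => hdelta.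
have q0 : (0 < q)%N by apply: ltnW.
(* A state holds the time, the current integer and the index [k] of the next real to avoid. If [q]
   does not divide [p * a], two consecutive integers [b], [b + 1] are admissible, and as
   [2 * delta < 1] the point [f k * zeta^(n+1)] is within [delta] of at most one of them. *)
pose step (x : nat * (int * nat)) (y : int * nat) :=
  `|q%:Z * y.1 - p%:Z * x.2.1| <= q%:Z - 1 /\
  ((y.2 = x.2.2 /\ q%:Z * y.1 = p%:Z * x.2.1) \/
   (y.2 = x.2.2.+1 /\
    delta < `|f x.2.2 * (p%:R / q%:R) ^+ x.1.+1 - y.1%:~R|)).
have hstep x : exists y, step x y.
  case: x => n [a k]; rewrite /step /=.
  have := divz_eq (p%:Z * a) q%:Z.
  have qz : 0 < q%:Z by [].
  have := ltz_pmod (p%:Z * a) qz; have := modz_ge0 (p%:Z * a) (lt0r_neq0 qz).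
  move: (p%:Z * a) (divz _ _) (modz _ _) => c b r r0 rq hc.
  have [r00|r1] := eqVneq r 0.
    by exists (b, k) => /=; split; [nia | left; split => //; nia].
  have [h|h] := ltP delta `|f k * (p%:R / q%:R) ^+ n.+1 - b%:~R|.
    by exists (b, k.+1) => /=; split; [nia | right].
  exists (b + 1, k.+1) => /=; split; first by nia.
  right; split=> //; rewrite intrD ltr_normr.
  by move: h; rewrite ler_norml => /andP[? ?]; apply/orP; right; lra.
have [g hg] := choice hstep.
pose st := fix st n := if n is m.+1 then g (m, st m) else (1 : int, 0%N).
pose u n := (st n).1.
have hst n : step (n, st n) (st n.+1) by exact: hg.
have [alpha hal] : exists alpha : R, forall n,
    `|alpha * (p%:R / q%:R) ^+ n - (u n)%:~R| <= delta.
  apply: shadowing; first by rewrite q0.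
  move=> n; have [h _] := hst n.
  by move: h; rewrite -(ler_int R) intr_norm [leRHS]intrB.
(* Positivity propagates because [q * u n.+1 >= p - (q - 1) > 0]. *)
have upos n : 1 <= u n.
  elim: n => [//|n IH]; have [h _] := hst n; move: h IH; rewrite -/(u n) -/(u n.+1).
  by move: (u n) (u n.+1) => a b; nia.
have alpha0 : alpha != 0.
  apply/eqP => a0; have := hal 0%N; rewrite a0 mul0r sub0r normrN normr1.
  by lra.
exists alpha; split; first exact: (varpi_intro _ _ _ _ u).
(* An endless run of divisible steps would force [u m = 0], against [upos]; so the index always
   advances again. *)
have leave m : exists n, (m <= n)%N /\ (st n).2 = (st m).2 /\
    (st n.+1).2 = (st m).2.+1 /\
    delta < `|f (st m).2 * (p%:R / q%:R) ^+ n.+1 - (u n.+1)%:~R|.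
  apply: contrapT => hno.
  have hfix i : (st (m + i)%N).2 = (st m).2 /\
      q%:Z * u (m + i).+1 = p%:Z * u (m + i)%N.
    elim: i => [|i [IH _]].
      rewrite addn0; split => //; have [_ [[_ //]|[h1 h2]]] := hst m.
      by case: hno; exists m.
    have e : (st (m + i.+1)%N).2 = (st m).2.
      rewrite addnS; have [_ [[h _]|[h1 h2]]] := hst (m + i)%N.
        by rewrite h.
      case: hno; exists (m + i)%N; split; first exact: leq_addr.
      by rewrite -IH.
    split => //; have [_ [[_ //]|[h1 h2]]] := hst (m + i.+1)%N.
    case: hno; exists (m + i.+1)%N; split; first exact: leq_addr.
    by rewrite -e.
  have := upos m; rewrite -[m]addn0.
  rewrite (iter_div_eq0 p q (fun i => u (m + i)%N)) // => i.
  by rewrite addnS; case: (hfix i).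
have reach k : exists m, (st m).2 = k.
  elim: k => [|k [m hm]]; first by exists 0%N.
  by have [n [_ [_ [h _]]]] := leave m; exists n.+1; rewrite h hm.
(* When the index passes [k], the orbit of [f k] is farther than [delta] from the chosen integer,
   and that of [alpha] is not. *)
move=> k hk; have [m hm] := reach k; have [n [_ [_ [_ ]]]] := leave m.
by rewrite hm -hk => h; have := hal n.+1; rewrite leNgt h.
Qed.

(** Inverting an injection of [A] into the naturals gives an [f] whose values cover [A], with 0 at
    the numbers not attained. *)
Lemma not_countable_of_avoid (R : realType) (A : set R) :
  (forall f : nat -> R, exists alpha, A alpha /\ forall k, alpha <> f k) ->
  ~ countable A.
Proof.
move=> hA /countable_injP[g ginj].
have hinv n : exists x, forall y, A y -> g y = n -> y = x.
  have [[x [Ax gx]]|h] := pselect (exists x, A x /\ g x = n); last first.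
    by exists 0 => y Ay gy; case: h; exists y.
  by exists x => y Ay gy; apply: ginj; rewrite ?inE // gy.
have [f hf] := choice hinv.
have [alpha [Aal hal]] := hA f.
exact: (hal (g alpha)) (hf _ _ Aal erefl).
Qed.

Lemma varpi_mono (R : realType) (zeta eps eps' : R) :
  eps <= eps' -> varpi eps zeta `<=` varpi eps' zeta.
Proof.
move=> h a [a0 [n0 hn0]]; split => //; exists n0 => n /hn0 hn.
exact: le_trans hn h.
Qed.

(* For [eps >= 1/2] all nonzero reals belong to [varpi eps zeta], so the
   avoidance argument can be run with any base, e.g. 5/2. *)
Lemma varpi_half_uncountable (R : realType) (zeta eps : R) :
  1 / 2 <= eps -> ~ countable (varpi eps zeta).
Proof.
move=> heps; apply: not_countable_of_avoid => f.
have [alpha [[a0 _] hal]] : exists alpha : R,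
    varpi ((2%:R - 1) / (5%:R - 2%:R)) (5%:R / 2%:R) alpha /\
    forall k, alpha <> f k 
      by apply: varpi_avoid => //; rewrite ltr_pdivrMr; lra.
by exists alpha; split => //; apply: varpi_full.
Qed.

Lemma varpi_uncountable (R : realType) (p q : nat) (eps : R) :
  (q < p)%N -> (2 <= q)%N -> coprime p q ->
  (q%:R - 1) / (p%:R - q%:R) <= eps -> ~ countable (varpi eps (p%:R / q%:R)).
Proof.
(* Avoidance needs a radius below 1/2, which [eps < 1/2] supplies. *)
move=> hpq hq hcop heps; have [h|h] := leP (1 / 2) eps.
  exact: varpi_half_uncountable.
apply: not_countable_of_avoid => f.
have [alpha [hal hf]] := varpi_avoid R p q f hpq hq hcop (le_lt_trans heps h).
by exists alpha; split => //; apply: varpi_mono heps _ hal.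
Qed.

(* The nonzero residues are given alternating signs, so that the error lies in
   [0, 1/p] or [-1/p, 0] according to the sign [b] of the next one. *)
Lemma varpi_denom2_neq0 (R : realType) (p : nat) (eps : R) :
  (2 < p)%N -> odd p -> 1 / p%:R <= eps -> varpi eps (p%:R / 2) <> set0.
Proof.
move=> p2 podd heps.
have p0 : 2 < p%:R :> R by rewrite ltr_nat.
pose step (x y : int * bool) :=
  (2 * y.1 = p%:Z * x.1 /\ y.2 = x.2) \/
  (2 * y.1 = p%:Z * x.1 + (if x.2 then 1 else -1) /\ y.2 = ~~ x.2).
have hstep x : exists y, step x y.
  case: x => a b; rewrite /step /=.
  have := divz_eq (p%:Z * a) 2.
  have := ltz_pmod (p%:Z * a) (isT : 0 < 2 :> int).
  have := modz_ge0 (p%:Z * a) (isT : 2 != 0 :> int).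
  move: (p%:Z * a) (divz _ _) (modz _ _) => c k r r0 rq hc.
  have [r00|r1] := eqVneq r 0.
    by exists (k, b) => /=; left; split => //; lia.
  exists (if b then k + 1 else k, ~~ b) => /=; right; split => //.
  by case: b; lia.
have [g hg] := choice hstep.
pose st n := iter n g (1 : int, true).
have hst n : step (st n) (st n.+1) by exact: hg.
pose r (b : bool) : R := if b then 1 / p%:R else 0.
have r_ge0 b : 0 <= r b by case: b => //=; rewrite divr_ge0 // ler0n.
have r_le b : r b <= 1 / p%:R by case: b => //=; rewrite divr_ge0 // ler0n.
have pinv : p%:R * (1 / p%:R) = 1 :> R by rewrite mulrCA divff ?mulr1 //; lra.
have pinv2 : 2 * (1 / p%:R) <= 1 :> R by rewrite mulrA mulr1 ler_pdivrMr; lra.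
have real_step n : (2 * (st n.+1).1%:~R = p%:R * (st n).1%:~R :> R /\
     (st n.+1).2 = (st n).2) \/
  (2 * (st n.+1).1%:~R = p%:R * (st n).1%:~R + (if (st n).2 then 1 else -1) :> R /\
     (st n.+1).2 = ~~ (st n).2).
  case: (hst n) => -[/(congr1 (intr : int -> R)) h1 h2]; [left|right]; split => //.
    by move: h1; rewrite !intrM -pmulrn.
  by move: h1; rewrite intrD !intrM -pmulrn; case: ifP.
(* The intervals are [[u, u + 1/p]] or [[u - 1/p, u]] by the sign. At a nonzero residue one end is
   sent exactly to the next integer, as [p/2 * (u + 1/p) = (p u + 1) / 2]; hence the radius
   [1/p]. *)
have [alpha hal] : exists alpha : R, forall n,
    (st n).1%:~R - r (~~ (st n).2) <= alpha * (p%:R / 2) ^+ n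
      <= (st n).1%:~R + r (st n).2.
  apply: nested_scaled_itv.
  - by lra.
  - by move=> n; have := r_ge0 (st n).2; have := r_ge0 (~~ (st n).2); lra.
  - move=> n; rewrite mulrAC ler_pdivrMr // /r.
    by case: (real_step n) => -[h ->]; move: h; case: (st n).2 => /= h; lra.
  - move=> n; rewrite mulrAC ler_pdivlMr // /r.
    by case: (real_step n) => -[h ->]; move: h; case: (st n).2 => /= h; lra.
have : varpi eps (p%:R / 2) alpha.
  apply: (varpi_intro _ _ _ _ (fun n => (st n).1)).
    (* The initial interval is [[1, 1 + 1/p]], which misses 0. *)
    apply/eqP => a0; have /andP[] := hal 0%N.
    by rewrite a0 mul0r /= subr0 ler10.
  move=> n; apply: le_trans heps; have /andP[] := hal n.
  have := r_le (st n).2; have := r_le (~~ (st n).2).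
  by rewrite ler_norml => *; apply/andP; split; lra.
by move=> h h0; rewrite h0 in h.
Qed.

(** * Bounds for the two constants *)

Lemma eps1_le (R : realType) (zeta b : R) :
  0 <= b -> (forall eps, b <= eps -> varpi eps zeta <> set0) -> eps1 zeta <= b.
Proof.
move=> b0 h; apply: sup_le => // x [_ hx]; rewrite leNgt.
by apply/negP => /ltW/h.
Qed.

Lemma eps2_le (R : realType) (zeta b : R) :
  0 <= b -> (forall eps, b <= eps -> ~ countable (varpi eps zeta)) ->
  eps2 zeta <= b.
Proof.
move=> b0 h; apply: sup_le => // x [_ hx]; rewrite leNgt.
by apply/negP => /ltW/h.
Qed.

Lemma varpi_half_neq0 (R : realType) (zeta eps : R) :
  1 / 2 <= eps -> varpi eps zeta <> set0.
Proof.
move=> heps h0; have := varpi_full R zeta eps 1 heps (oner_neq0 R).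
by rewrite h0.
Qed.

Lemma eps1_ge (R : realType) (zeta t : R) :
  (forall eps, 0 < eps < t -> varpi eps zeta = set0) -> t <= eps1 zeta.
Proof.
move=> h; apply: (sup_ge _ _ _ (1 / 2)).
  move=> x [x0 hx]; rewrite (ltW x0) leNgt /=; apply/negP => /ltW hx2.
  exact: varpi_half_neq0 hx2 hx.
by move=> x hx; split; [case/andP: hx | exact: h].
Qed.

Lemma eps2_ge (R : realType) (zeta t : R) :
  (forall eps, 0 < eps < t -> countable (varpi eps zeta)) -> t <= eps2 zeta.
Proof.
move=> h; apply: (sup_ge _ _ _ (1 / 2)).
  move=> x [x0 hx]; rewrite (ltW x0) leNgt /=; apply/negP => /ltW hx2.
  exact: varpi_half_uncountable hx2 hx.
by move=> x hx; split; [case/andP: hx | exact: h].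
Qed.

Theorem theorem2p6 (R : realType) (p q : nat)
    (hpq : (q < p)%N) (hq : (2 <= q)%N) (hcop : coprime p q) :
  let P : R := p%:R in
  let Q : R := q%:R in
  let zeta : R := P / Q in
  [/\ tau R p q <= eps1 zeta <= Num.min (1 / 2) (Q / (2 * (P - Q))),
      Num.max (tau R p q) (Q / (2 * (P + Q))) <= eps2 zeta
        <= Num.min (1 / 2) ((Q - 1) / (P - Q)),
      odd q ->
        eps1 zeta <= Num.min (1 / 2) ((Q - 1) / (2 * (P - Q))) /\
        Num.max (tau R p q) ((Q + 1) / (2 * (P + Q))) <= eps2 zeta
    & q = 2%N -> eps1 zeta <= 1 / P].
Proof.
move=> P Q zeta.
have q0 : (0 < q)%N by apply: ltnW.
have qp : (0 < q < p)%N by rewrite q0.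
have Q2 : 2 <= Q by rewrite ler_nat.
have QP : Q < P by rewrite ltr_nat.
have half0 : 0 <= 1 / 2 :> R by lra.
have tau1 : tau R p q <= eps1 zeta.
  by apply: eps1_ge => eps /andP[_]; exact: varpi_below_tau.
have tau2 : tau R p q <= eps2 zeta.
  apply: eps2_ge => eps /andP[_ h].
  by rewrite /zeta (varpi_below_tau R p q eps hpq hq hcop h); exact: countable0.
have eps1_half : eps1 zeta <= 1 / 2 := eps1_le _ _ _ half0 (varpi_half_neq0 R zeta).
(* [M] is twice the residue bound: [q] in general, [q - 1] for odd [q]. *)
have eps1_residue (M : R) : 0 <= M ->
    (forall s : int, 2 * `|s| <= q%:Z -> 2 * `|s%:~R| <= M) ->
    eps1 zeta <= M / (2 * (P - Q)).
  move=> M0 hM; apply: eps1_le => [|eps].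
    by rewrite divr_ge0 // mulr_ge0 // subr_ge0 ltW.
  have -> : M / (2 * (P - Q)) = M / 2 / (P - Q) by field; lra.
  apply: varpi_neq0 => // a; have [b /hM hb] := nearest_step p q a q0.
  by exists b; lra.
have eps2_residue (M : R) :
    (forall s : int, 2 * `|s%:~R| < M -> 2 * `|s| < q%:Z) ->
    M / (2 * (P + Q)) <= eps2 zeta.
  move=> hM; apply: eps2_ge => eps /andP[_ h].
  apply: (varpi_countable _ _ _ _ _ hpq q0 h) => s hs; apply: hM.
  rewrite -ltr_pdivlMl // (lt_le_trans hs) //.
  by rewrite le_eqVlt; apply/orP; left; apply/eqP; rewrite -/P -/Q; field; lra.
split.
- rewrite tau1 le_min eps1_half /=; apply: eps1_residue; first by lra.
  by move=> s; rewrite -(ler_int R) intrM intr_norm -pmulrn.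
- rewrite ge_max tau2 le_min; apply/and3P; split.
  + by apply: eps2_residue => s; rewrite -(ltr_int R) intrM intr_norm -pmulrn.
  + by apply: eps2_le => // eps; exact: varpi_half_uncountable.
  + apply: eps2_le => [|eps]; last exact: varpi_uncountable.
    by rewrite divr_ge0 //; lra.
(* Since [2|s|] is even, for odd [q] the bound [2|s| <= q] sharpens to [q - 1], and [2|s| < q + 1]
   already gives [2|s| < q]. *)
- move=> qodd; split.
    rewrite le_min eps1_half /=; apply: eps1_residue; first by lra.
    move=> s hs; have {}hs : 2 * `|s| <= q%:Z - 1 by lia.
    by move: hs; rewrite -(ler_int R) intrB intrM intr_norm -pmulrn.
  rewrite ge_max tau2; apply: eps2_residue => s hs.
  have {}hs : 2 * `|s| < q%:Z + 1.
    by rewrite -(ltr_int R) intrD intrM intr_norm -pmulrn.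
  by lia.
- move=> q2; apply: eps1_le => [|eps]; first by rewrite divr_ge0 // ler0n.
  rewrite /zeta /P /Q; move: hpq hcop; rewrite q2 => p2 hcop2.
  by apply: varpi_denom2_neq0 => //; rewrite -coprimen2.
Qed.
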